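(* Let $m\ge 1$ and $k\ge 1$ be natural numbers, and let $\epsilon>0$. Then there exist a sequence of random variables $\{X_i\}_{i=1}^{\infty}$ (on a common probability space), each taking the values $+1$ and $-1$ with probability $\frac12$ each, which are $k$-wise independent, and a (deterministic) strictly increasing infinite sequence of positive integers $(I_j)_{j\ge 1}$, such that, with $S_n=\sum_{i=1}^{n}X_i$, $$\mathbb{P}\left(S_{I_j}\equiv 0 \pmod m\right)>1-\epsilon\qquad\text{for all } j.$$
   Context: A family of random variables is $k$-wise independent if every $k$ of them (with distinct indices) are mutually independent. *)

(* Defs.v *)
From HB Require Import structures.
From mathcomp Require Import all_boot all_order all_algebra.
From mathcomp Require Import all_classical all_reals all_analysis.

Set Implicit Arguments.
Unset Strict Implicit.
Unset Printing Implicit Defensive.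

Import Order.TTheory GRing.Theory Num.Theory.
Import numFieldNormedType.Exports.

Local Open Scope classical_set_scope.
Local Open Scope ring_scope.

Definition mutually_independent d (T : measurableType d) (R : realType)
    (P : probability T R) (I : finType) (X : I -> {RV P >-> R}) : Prop :=
  forall (J : {set I}) (B : I -> set R),
    (forall i, measurable (B i)) ->
    P (\bigcap_(i in [set i | i \in J]) X i @^-1` B i) =
    (\prod_(i in J) P (X i @^-1` B i))%E.

Definition kwise_independent d (T : measurableType d) (R : realType)
    (P : probability T R) (k : nat) (X : nat -> {RV P >-> R}) : Prop :=
  forall f : 'I_k -> nat, injective f ->
    mutually_independent (fun a : 'I_k => X (f a)).

Definition fair_sign d (T : measurableType d) (R : realType)
    (P : probability T R) (Y : {RV P >-> R}) : Prop :=
  distribution P Y [set 1] = (2^-1)%:E /\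
  distribution P Y [set -1] = (2^-1)%:E.

(* Families are indexed from 0: the term of index i is the (i+1)-st variable,
   so this is the sum of the first n variables. *)
Definition partial_sum d (T : measurableType d) (R : realType)
    (P : probability T R) (X : nat -> {RV P >-> R}) (n : nat) (w : T) : R :=
  \sum_(i < n) X i w.

(* x = y (mod m) in R, i.e. x - y is an integer multiple of m; on integers
   this is the usual congruence. The sums to which it is applied are
   real-valued, and almost surely integers. *)
Definition eq_mod (R : realType) (m : nat) (x y : R) : Prop :=
  exists z : int, x - y = z%:~R * m%:R.

(* Main.v *)
Require Import Defs.
From mathcomp Require Import all_boot all_order all_algebra all_field.
From mathcomp Require Import ring lra zify.
From mathcomp Require all_classical all_reals all_analysis.

(** Bits are encoded as signs, and an outcome of [n] signs as the set
    [x : {set 'I_n}] of the positions that carry [-1]; then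
    [(-1) ^+ #|A :&: x|] is the product of the signs over [A], and the sum of
    all [n] signs is [n - 2 * #|x|].

    The heart of the proof is a law on a single block of [n] signs, with
    [m %| n], that is [k]-wise independent and uniform on each sign although it
    charges only outcomes with [m %| #|x|], so that the block sum is always a
    multiple of [m] ([block_law]).  Independent copies of such a block, put one
    after the other, are still [k]-wise independent, and the sum of the first
    [n * (j + 1)] signs is divisible by [m] almost surely.

    Why the block law exists.  Under the uniform law, the event
    [m %| #|x|] is nearly uncorrelated with every product of few signs:
    writing the event as an average over the [m]-th roots of unity turns the
    correlation into an average of products of factors [1 + z ^ t] or
    [1 - z ^ t], and as [`|1 + z ^ t| < 2] for [0 < t < m], it is exponentially
    small in [n] once the term [t = 0] is set aside ([charsum_bound]).  There
    are only polynomially many products of at most [k] signs, so the uniform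
    law conditioned on the event becomes exactly [k]-wise independent after
    multiplication by a density [1 + \sum_A c A * (-1) ^+ #|A :&: x|], whose
    coefficients solve a linear system that is a small perturbation of the
    identity ([perturbed_identity_solvable]); their sum is so small that the
    density is positive.

    An infinite i.i.d. sequence of blocks is realized on the unit interval as
    the digits of a uniform point in a number system whose digit intervals
    have the prescribed probabilities as lengths ([iid_sequence]).  Finally,
    the indicator of an event on one sign is an affine function of that sign;
    expanding the product of [k] such functions leaves only the constant term
    ([independent_blocks_expectation]). *)

Set Implicit Arguments.
Unset Strict Implicit.
Unset Printing Implicit Defensive.

Import Order.TTheory GRing.Theory Num.Theory.

Local Open Scope ring_scope.

(** * Correlation of divisibility of the size with sign products *)

(** Up to the factor [2 ^ n], the Walsh coefficient at [A] of the event
    [m %| #|x|].  It is an integer, which carries its estimate from the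
    algebraic numbers, where roots of unity are available, to other fields. *)
Definition charsum (n m : nat) (A : {set 'I_n}) : int :=
  \sum_(x : {set 'I_n} | (m %| #|x|)%N) (-1) ^+ #|A :&: x|.

Lemma sum_unity_root (F : fieldType) (m r : nat) (z : F) :
  m.-primitive_root z ->
  \sum_(t < m) z ^+ (t * r) = if (m %| r)%N then m%:R else 0.
Proof.
move=> zP; have m0 := prim_order_gt0 zP.
under eq_bigr do rewrite mulnC exprM.
rewrite (prim_order_dvd zP); case: eqP => [->|/eqP zr].
  by under eq_bigr do rewrite expr1n; rewrite sumr_const card_ord.
have zr0 : z ^+ r - 1 != 0 by rewrite subr_eq0.
apply: (mulfI zr0); rewrite -subrX1 -exprM mulnC exprM (prim_expr_order zP).
by rewrite expr1n subrr mulr0.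
Qed.

(** The condition [m %| #|x|] is an average of the powers [z ^+ (t * #|x|)],
    and for each [t] the summand is a product over the positions, so that the
    sum over [x] factors. *)
Lemma charsum_unity_root (F : fieldType) (n m : nat) (A : {set 'I_n}) (z : F) :
  m.-primitive_root z ->
  m%:R * (charsum m A)%:~R = \sum_(t < m) \prod_(i < n) ((-1) ^+ (i \in A) * z ^+ t + 1).
Proof.
move=> zP.
have E (t : 'I_m) : \prod_(i < n) ((-1) ^+ (i \in A) * z ^+ t + 1) =
   \sum_(x : {set 'I_n}) (-1) ^+ #|A :&: x| * z ^+ (t * #|x|).
  rewrite bigA_distr; apply: eq_big => // x _.
  rewrite -big_mkcond /= big_split /= !prodr_const -exprM; congr (_ * _).
  rewrite prodrXr -sum1_card big_mkcond [in RHS]big_mkcond; congr (_ ^+ _).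
  by apply: eq_bigr => i _; rewrite inE andbC; do 2!case: (_ \in _).
under eq_bigr do rewrite E.
rewrite exchange_big /= /charsum rmorph_sum /= mulr_sumr big_mkcond.
apply: eq_bigr => x _; rewrite -mulr_sumr sum_unity_root //.
by case: ifP => _; rewrite ?mulr0 // rmorphXn rmorphN rmorph1 mulrC.
Qed.

Lemma norm_unity_root (m : nat) (z : algC) (t : nat) :
  m.-primitive_root z -> `|z ^+ t| = 1.
Proof.
move=> zP; apply/eqP; rewrite -(pexpr_eq1 (prim_order_gt0 zP)) // -normrX.
by rewrite -exprM mulnC exprM (prim_expr_order zP) expr1n normr1.
Qed.

Lemma norm_unity_root_add1 (m : nat) (z : algC) (t : nat) :
  m.-primitive_root z -> (0 < t < m)%N -> `|z ^+ t + 1| < 2.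
Proof.
move=> zP /andP[t0 tm]; have zt := norm_unity_root t zP.
rewrite lt_neqAle (le_trans (ler_normD _ _)) ?zt ?normr1 // andbT.
apply/eqP => h.
have [|u _ [zu ou]] := @normCDeq _ (z ^+ t) 1; first by rewrite zt normr1 h.
have: (m %| t)%N.
  by rewrite (prim_order_dvd zP) zu zt; move: ou; rewrite normr1 => <-.
by rewrite gtnNdvd.
Qed.

(** A uniform gap for finitely many numbers [`|z ^+ t + 1| / 2 < 1]: the
    product of their distances to [1] is below each of these distances.  This
    avoids a maximum, the order of [algC] being partial. *)
Lemma unity_root_gap (m : nat) (z : algC) : m.-primitive_root z ->
  exists2 c : algC, 0 <= c < 1 &
    forall t, (0 < t < m)%N -> `|z ^+ t + 1| <= 2 * c.
Proof.
move=> zP; have m0 := prim_order_gt0 zP.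
pose a (t : 'I_m) := 1 - `|z ^+ t + 1| / 2.
have a01 (t : 'I_m) : (0 < t)%N -> 0 < a t <= 1.
  move=> t0; rewrite /a subr_gt0 ltr_pdivrMr // mul1r.
  rewrite (norm_unity_root_add1 zP) ?t0 ?ltn_ord //=.
  by rewrite gerBl divr_ge0.
exists (1 - \prod_(t < m | (0 < t)%N) a t).
  rewrite subr_ge0 gtrBl prodr_gt0 ?andbT; last by move=> t /a01/andP[].
  by apply: prodr_ile1 => t /a01/andP[/ltW-> ->].
move=> t /andP[t0 tm]; pose i := Ordinal tm.
have: \prod_(t < m | (0 < t)%N) a t <= a i.
  rewrite (bigD1 i) //= ler_piMr //; first by have /andP[/ltW] := a01 i t0.
  by apply: prodr_ile1 => j /andP[/a01/andP[/ltW-> ->]].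
rewrite {2}/a /= => h.
rewrite -[X in X <= _](@divfK _ 2) ?pnatr_eq0 // mulrC ler_pM2l ?ltr0n //.
by rewrite lerBrDl -lerBrDr.
Qed.

(** With [a = 1 - c], Bernoulli's inequality yields
    [c ^+ q * (a * q%:R) <= 1], and the power [l + 1] of this beats [q ^ l] by
    a factor [q]. *)
Lemma exp_beats_poly (c : algC) (C l : nat) : 0 <= c < 1 ->
  exists2 q : nat, (0 < q)%N & C%:R * q%:R ^+ l * c ^+ (q * l.+1) <= 1.
Proof.
move=> /andP[c0 c1]; pose a := 1 - c.
have a0 : 0 < a by rewrite subr_gt0.
have [q hq] : exists q : nat, C%:R / a ^+ l.+1 < q%:R.
  exists (Num.Def.archi_bound (C%:R / a ^+ l.+1)); rewrite archi_boundP //.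
  by rewrite divr_ge0 // exprn_ge0 // ltW.
have q0 : (0 < q)%N.
  rewrite -(ltr0n algC); apply: le_lt_trans hq.
  by rewrite divr_ge0 // exprn_ge0 // ltW.
exists q => //.
have aq0 : 0 < a * q%:R by rewrite mulr_gt0 // ltr0n.
have bern : c ^+ q * (1 + a * q%:R) <= 1.
  elim: q {hq q0 aq0} => [|q IH]; first by rewrite expr0 mulr0 addr0 mulr1.
  apply: le_trans IH; rewrite exprSr -mulrA ler_wpM2l ?exprn_ge0 //.
  rewrite -subr_ge0 (_ : _ - _ = a ^+ 2 * q.+1%:R) ?mulr_ge0 ?exprn_ge0 ?ltW //.
  by rewrite /a -natr1; ring.
have cq : c ^+ q * (a * q%:R) <= 1.
  by apply: le_trans bern; rewrite ler_wpM2l ?exprn_ge0 // lerDr.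
have cql : c ^+ (q * l.+1) * (a * q%:R) ^+ l.+1 <= 1.
  rewrite exprM -exprMn exprn_ile1 // mulr_ge0 ?exprn_ge0 // ltW //.
apply: le_trans cql; rewrite mulrC ler_wpM2l ?exprn_ge0 //.
rewrite exprMn [q%:R ^+ l.+1]exprS mulrA ler_wpM2r ?exprn_ge0 //.
by move: hq; rewrite ltr_pdivrMr ?exprn_gt0 // mulrC => /ltW.
Qed.

(** The term [t = 0] of the average over the roots of unity is the uniform
    mean of the sign product, that is [0] unless [A] is empty.  In the other
    terms all factors but those of [A] are at most [2 * c]. *)
Lemma charsum_bound (n m l : nat) (z c : algC) (A : {set 'I_n}) :
  m.-primitive_root z -> 0 <= c < 1 ->
  (forall t, (0 < t < m)%N -> `|z ^+ t + 1| <= 2 * c) ->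
  (l <= n)%N -> (#|A| <= l)%N ->
  `|m%:R * (charsum m A)%:~R - (A == set0)%:R * 2 ^+ n| <= m%:R * 2 ^+ n * c ^+ (n - l).
Proof.
move=> zP /andP[c0 c1] hc ln Al; have m0 := prim_order_gt0 zP.
rewrite (charsum_unity_root A zP) (bigD1 (Ordinal m0)) //= expr0.
under eq_bigr do rewrite mulr1.
have -> : \prod_(i < n) ((-1) ^+ (i \in A) + 1) = (A == set0)%:R * 2 ^+ n :> algC.
  case: eqP => [->|/eqP/set0Pn[i iA]].
    under eq_bigr do rewrite inE expr0.
    by rewrite mul1r prodr_const card_ord.
  by rewrite (bigD1 i) //= iA expr1 addNr !mul0r.
rewrite addrAC subrr add0r.
apply: le_trans (ler_norm_sum _ _ _) _.
have bnd (t : 'I_m) : t != Ordinal m0 ->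
  `|\prod_(i < n) ((-1) ^+ (i \in A) * z ^+ t + 1)| <= 2 ^+ n * c ^+ (n - l).
  move=> t0; have {}t0 : (0 < t)%N by rewrite lt0n.
  have c2 : `|z ^+ t + 1| <= 2 * c by rewrite hc ?t0 /=.
  have zt := norm_unity_root t zP.
  have le_f (i : 'I_n) : 0 <= `|(-1) ^+ (i \in A) * z ^+ t + 1|
      <= 2 * (if i \in ~: A then c else 1).
    rewrite normr_ge0 inE; case: (i \in A) => /=; last by rewrite expr0 mul1r.
    rewrite (le_trans (ler_normD _ _)) // normr1 normrM normrX normrN normr1.
    by rewrite expr1 mul1r zt mulr1.
  rewrite normr_prod; apply: le_trans (ler_prod _ (fun i _ => le_f i)) _.
  rewrite big_split /= prodr_const card_ord -big_mkcond /= prodr_const.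
  rewrite ler_wpM2l ?exprn_ge0 // ler_wiXn2l ?(ltW c1) //.
  by rewrite cardsCs setCK card_ord leq_sub2l.
apply: le_trans (ler_sum _ bnd) _.
rewrite sumr_const -mulrA -[leLHS]mulr_natl ler_wpM2r //.
  by rewrite mulr_ge0 ?exprn_ge0.
by rewrite ler_nat (leq_trans (max_card _)) // card_ord.
Qed.

(** The factor [4 * n.+1 ^ l] is the margin that the linear system for the
    block law needs: [n.+1 ^ l] dominates the number of its unknowns. *)
Lemma charsum_small (m l : nat) : (0 < m)%N ->
  exists n : nat, [/\ (0 < n)%N, (m %| n)%N &
    forall A : {set 'I_n}, (#|A| <= l)%N ->
      4 * n.+1%:R ^+ l * `|m%:R * charsum m A - (A == set0)%:R * 2 ^+ n|
      <= 2 ^+ n :> int].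
Proof.
move=> m0; have [z zP] := C_prim_root_exists m0.
have [c c01 hc] := unity_root_gap zP.
(* [C0] is such that the block size [n] below satisfies [n < q * C0]. *)
pose C0 := (m * (l.+1 + l)).+1.
have [q q0 hq] := exp_beats_poly (4 * m * C0 ^ l) l c01.
have /andP[c0 c1] := c01.
pose n := (m * (l + q * l.+1))%N.
have nl : (l + q * l.+1 <= n)%N by rewrite leq_pmull.
exists n; split.
- by rewrite (leq_trans _ nl) // addnC ltn_addr // muln_gt0 q0.
- exact: dvdn_mulr.
move=> A Al; rewrite -(ler_int algC) !intrM intr_norm intrB !intrM !rmorphXn !rmorph_nat.
have h := charsum_bound zP c01 hc (leq_trans (leq_addr _ _) nl) Al.
have nC : (n.+1 <= q * C0)%N.
  by have := leq_pmull (m * l) q0; rewrite /C0 /n; nia.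
apply: le_trans (ler_wpM2l _ h) _; first by rewrite mulr_ge0 ?exprn_ge0.
have cn : c ^+ (n - l) <= c ^+ (q * l.+1).
  by rewrite ler_wiXn2l ?(ltW c1) // leq_subRL // (leq_trans (leq_addr _ _) nl).
have nn : n.+1%:R ^+ l <= (q * C0)%:R ^+ l :> algC.
  by rewrite lerXn2r ?nnegrE ?ler_nat.
rewrite [leLHS](_ : _ = 2 ^+ n * (4 * m%:R * n.+1%:R ^+ l * c ^+ (n - l))); last by ring.
rewrite -[leRHS]mulr1 ler_wpM2l ?exprn_ge0 //.
apply: le_trans hq.
rewrite !natrM natrX in nn *.
rewrite [leRHS](_ : _ = 4 * m%:R * (q%:R * C0%:R) ^+ l * c ^+ (q * l.+1)).
  rewrite ler_pM ?mulr_ge0 ?exprn_ge0 //.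
  by rewrite ler_wpM2l ?mulr_ge0.
by rewrite exprMn; ring.
Qed.

(** * A block law supported on outcomes of divisible size *)

(** The perturbation contracts the l1 norm by a factor [4], so the matrix of
    the system is injective, hence invertible; the solution has norm [s] with
    [s <= 1/4 + s/4]. *)
Lemma perturbed_identity_solvable (R : realFieldType) (L : finType)
    (E : L -> L -> R) (e : L -> R) :
  (forall b, \sum_a `|E a b| <= 4^-1) -> \sum_a `|e a| <= 4^-1 ->
  exists2 c : L -> R, (forall a, c a + \sum_b E a b * c b = - e a) &
    \sum_a `|c a| <= 3^-1.
Proof.
move=> hE he.
have l1 (c : L -> R) : \sum_a `|\sum_b E a b * c b| <= 4^-1 * \sum_b `|c b|.
  apply: le_trans (_ : \sum_a \sum_b `|E a b| * `|c b| <= _).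
    apply: ler_sum => a _; apply: le_trans (ler_norm_sum _ _ _) _.
    by apply: ler_sum => b _; rewrite normrM.
  rewrite exchange_big mulr_sumr; apply: ler_sum => b _.
  by rewrite -mulr_suml ler_wpM2r.
(* [M] is transposed, as row vectors are multiplied on the left. *)
pose M : 'M[R]_#|L| := \matrix_(i, j) ((i == j)%:R + E (enum_val j) (enum_val i)).
pose fn (v : 'rV[R]_#|L|) (a : L) := v 0 (enum_rank a).
have ME (v : 'rV_#|L|) a : (v *m M) 0 (enum_rank a) = fn v a + \sum_b E a b * fn v b.
  rewrite mxE (reindex_onto enum_rank enum_val) /=; last by move=> i _; rewrite enum_valK.
  under eq_bigl do rewrite enum_rankK eqxx.
  under eq_bigr do rewrite mxE mulrDr !enum_rankK (inj_eq enum_rank_inj).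
  rewrite big_split /=; congr (_ + _).
    rewrite (bigD1 a) //= eqxx mulr1 big1 ?addr0 // => b /negPf->.
    by rewrite mulr0.
  by apply: eq_bigr => b _; rewrite mulrC.
have Mu : M \in unitmx.
  rewrite -row_free_unit; apply: inj_row_free => v vM0.
  have v0 a : fn v a = - \sum_b E a b * fn v b.
    by apply/eqP; rewrite -addr_eq0 -ME vM0 mxE.
  have s0 : \sum_a `|fn v a| <= 0.
    have : \sum_a `|fn v a| <= 4^-1 * \sum_a `|fn v a|.
      by apply: le_trans (l1 _); apply: ler_sum => a _; rewrite {1}v0 normrN.
    by lra.
  have {}s0 : \sum_a `|fn v a| = 0 by apply/le_anti; rewrite s0 sumr_ge0.
  apply/rowP => i; rewrite mxE -(enum_valK i).
  have /eqP := psumr_eq0P (fun a _ => normr_ge0 (fn v a)) s0 (i := enum_val i) isT.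
  by rewrite normr_eq0 => /eqP.
pose v := (\row_i - e (enum_val i)) *m invmx M.
have vE a : fn v a + \sum_b E a b * fn v b = - e a.
  by rewrite -ME mulmxKV // mxE enum_rankK.
exists (fn v) => //.
have : \sum_a `|fn v a| <= \sum_a `|e a| + 4^-1 * \sum_a `|fn v a|.
  apply: le_trans (_ : \sum_a (`|e a| + `|\sum_b E a b * fn v b|) <= _).
    apply: ler_sum => a _; rewrite -[`|e a|]normrN -vE.
    by rewrite -[in leLHS](addrK (\sum_b E a b * fn v b) (fn v a)) ler_normB.
  by rewrite big_split /= lerD2l.
by lra.
Qed.

(** A set of at most [k] elements is the range of a partial function on
    [k] points. *)
Lemma card_small_sets (n k : nat) :
  (#|[set A : {set 'I_n} | (#|A| <= k)%N]| <= n.+1 ^ k)%N.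
Proof.
pose im (f : {ffun 'I_k -> option 'I_n}) := [set x | Some x \in codom f].
suff sub : [set A : {set 'I_n} | (#|A| <= k)%N] \subset im @: setT.
  apply: leq_trans (subset_leq_card sub) _.
  apply: leq_trans (leq_imset_card _ _) _.
  by rewrite cardsT card_ffun card_option !card_ord.
apply/subsetP => A; rewrite inE => Ak; apply/imsetP.
exists [ffun i : 'I_k => onth (enum A) i]; rewrite ?inE //.
apply/setP => x; rewrite inE; apply/idP/codomP => [xA|[i]].
  have ix : (index x (enum A) < k)%N.
    by apply: leq_trans Ak; rewrite cardE index_mem mem_enum.
  exists (Ordinal ix); rewrite ffunE /= onthE.
  by rewrite (nth_map x) ?index_mem ?nth_index ?mem_enum.
rewrite ffunE => /esym h; rewrite -mem_enum.
by apply/onthP; exists i.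
Qed.

Definition symdiff (T : finType) (A B : {set T}) := (A :\: B) :|: (B :\: A).

Lemma card_symdiff (T : finType) (A B : {set T}) :
  (#|symdiff A B| + (#|A :&: B|).*2 = #|A| + #|B|)%N.
Proof.
rewrite -(cardsID B A) -(cardsID A B) (setIC B A) /symdiff cardsU.
rewrite (_ : _ :&: _ = set0) ?cards0; first by lia.
by apply/setP => x; rewrite !inE; do 2!case: (_ \in _).
Qed.

Lemma symdiff_eq0 (T : finType) (A B : {set T}) : (symdiff A B == set0) = (A == B).
Proof. by rewrite setU_eq0 !setD_eq0 eqEsubset. Qed.

Lemma sign_symdiff (R : pzRingType) (T : finType) (A B x : {set T}) :
  (-1) ^+ #|symdiff A B :&: x| = (-1) ^+ #|A :&: x| * (-1) ^+ #|B :&: x| :> R.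
Proof.
rewrite -exprD -card_symdiff exprD -mul2n exprM sqrrN !expr1n mulr1.
congr (_ ^+ #|pred_of_set _|); apply/setP => i; rewrite !inE.
by do 3!case: (_ \in _).
Qed.

(** The law is the normalization of the event [m %| #|x|] times a density
    [1 + \sum_B c B * (-1) ^+ #|B :&: x|].  The product of the signs over [A]
    and over [B] is the product over [symdiff A B], so that the vanishing of
    the coefficient of the law at [A] is a linear equation in [c] whose matrix
    consists of the numbers [charsum m (symdiff A B)].  After division by
    [2 ^ n / m], these are [1] on the diagonal up to a small error and small
    elsewhere. *)
Lemma block_law (R : realFieldType) (m k : nat) : (0 < m)%N ->
  exists n (mu : {set 'I_n} -> R),
    [/\ (0 < n)%N, (m %| n)%N, forall x, 0 <= mu x, \sum_x mu x = 1 &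
    (forall x, mu x != 0 -> (m %| #|x|)%N) /\
    (forall A : {set 'I_n}, (0 < #|A| <= k)%N ->
      \sum_x mu x * (-1) ^+ #|A :&: x| = 0)].
Proof.
(* The symmetric difference of two sets of size [k] can have size [k + k]. *)
move=> m0; have [n [n0 mn hD]] := charsum_small (k + k) m0.
pose L := [set A : {set 'I_n} | (0 < #|A| <= k)%N].
pose N : R := n.+1%:R ^+ (k + k).
have N1 : 1 <= N by rewrite exprn_ege1 // ler1n.
have N0 : 0 < N by apply: lt_le_trans N1.
pose e (A : {set 'I_n}) : R := m%:R * (charsum m A)%:~R / 2 ^+ n - (A == set0)%:R.
have n2 : 0 < 2 ^+ n :> R by rewrite exprn_gt0.
have e_small (A : {set 'I_n}) : (#|A| <= k + k)%N -> `|e A| <= 4^-1 / N.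
  move=> /hD; rewrite -(ler_int R) !intrM intr_norm intrB !intrM !rmorphXn !rmorph_nat.
  have -> : e A = (m%:R * (charsum m A)%:~R - (A == set0)%:R * 2 ^+ n) / 2 ^+ n.
    by rewrite /e mulrBl mulfK // gt_eqF.
  rewrite normrM normfV (gtr0_norm n2) ler_pdivrMr // -invfM.
  by rewrite ler_pdivlMl ?mulr_gt0.
have sumL (F : {set 'I_n} -> R) :
    (forall A, A \in L -> 0 <= F A <= 4^-1 / N) -> \sum_(A in L) F A <= 4^-1.
  move=> hF; apply: le_trans (_ : \sum_(A in L) 4^-1 / N <= _).
    by apply: ler_sum => A /hF/andP[].
  rewrite sumr_const -[leLHS]mulr_natr mulrAC ler_pdivrMr //.
  rewrite ler_wpM2l ?invr_ge0 ?ler0n // /N -natrX ler_nat.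
  apply: leq_trans (_ : (n.+1 ^ k <= _)%N); last by rewrite leq_pexp2l // leq_addr.
  apply: leq_trans (card_small_sets n k); apply: subset_leq_card.
  by apply/subsetP => A; rewrite !inE => /andP[].
(* Cutting [E] and [e'] off outside [L] forces [c] to vanish there. *)
pose E (A B : {set 'I_n}) : R := if (A \in L) && (B \in L) then e (symdiff A B) else 0.
pose e' (A : {set 'I_n}) : R := if A \in L then e A else 0.
have [||c hc csmall] := @perturbed_identity_solvable R _ E e'.
- move=> B; apply: le_trans (_ : \sum_(A in L) `|E A B| <= _).
    rewrite [leRHS]big_mkcond; apply: ler_sum => A _; rewrite /E.
    by case: (A \in L) => //=; rewrite normr0.
  apply: sumL => A AL; rewrite normr_ge0 /E AL /=.
  case: ifP => [BL|_]; last by rewrite normr0 divr_ge0 ?invr_ge0 ?ler0n ?(ltW N0).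
  apply: e_small; rewrite -(leq_add2r (#|A :&: B|).*2) card_symdiff.
  move: AL BL; rewrite !inE => /andP[_ Ak] /andP[_ Bk].
  by rewrite (leq_trans (leq_add Ak Bk)) // leq_addr.
- apply: le_trans (_ : \sum_(A in L) `|e' A| <= _).
    rewrite [leRHS]big_mkcond; apply: ler_sum => A _; rewrite /e'.
    by case: (A \in L); rewrite ?normr0.
  apply: sumL => A AL; rewrite normr_ge0 /e' AL /= e_small //.
  by move: AL; rewrite inE => /andP[_ /leq_trans->//]; rewrite leq_addr.
have c0 A : A \notin L -> c A = 0.
  move=> /negPf AL; have := hc A; rewrite /E /e' AL /= oppr0.
  by under eq_bigr do rewrite mul0r; rewrite big1_eq addr0.
pose f (x : {set 'I_n}) : R := 1 + \sum_A c A * (-1) ^+ #|A :&: x|.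
have f_gt0 x : 0 < f x.
  have : `|(\sum_A c A * (-1) ^+ #|A :&: x|)| <= 3^-1.
    apply: le_trans csmall; apply: le_trans (ler_norm_sum _ _ _) _.
    apply: ler_sum => A _; by rewrite normrM normrX normrN normr1 expr1n mulr1.
  by rewrite ler_norml /f => /andP[h _]; lra.
pose g (x : {set 'I_n}) := if (m %| #|x|)%N then f x else 0.
have g_ge0 x : 0 <= g x by rewrite /g; case: ifP => // _; apply: ltW.
pose Z := \sum_x g x.
have Z0 : 0 < Z.
  rewrite /Z (bigD1 set0) //= ltr_wpDr ?sumr_ge0 //.
  by rewrite /g cards0 dvdn0.
have corr (A : {set 'I_n}) : \sum_x g x * (-1) ^+ #|A :&: x| =
    (charsum m A)%:~R + \sum_B c B * (charsum m (symdiff A B))%:~R.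
  have csE (B : {set 'I_n}) : (charsum m B)%:~R =
      \sum_(x : {set 'I_n} | (m %| #|x|)%N) (-1) ^+ #|B :&: x| :> R.
    rewrite /charsum rmorph_sum; apply: eq_bigr => x _.
    by rewrite rmorphXn rmorphN rmorph1.
  rewrite csE; under [X in _ + X]eq_bigr do rewrite csE mulr_sumr.
  rewrite [in RHS]exchange_big -big_split [RHS]big_mkcond.
  apply: eq_bigr => x _; rewrite /g; case: ifP => _; last by rewrite mul0r.
  rewrite mulrDl mul1r mulr_suml; congr (_ + _); apply: eq_bigr => B _.
  by rewrite sign_symdiff mulrA mulrAC.
have corr0 (A : {set 'I_n}) : A \in L -> \sum_x g x * (-1) ^+ #|A :&: x| = 0.
  move=> AL; have A0 : (A == set0) = false.
    by move: AL; rewrite inE -cards_eq0 lt0n => /andP[/negPf].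
  have mR : m%:R != 0 :> R by rewrite pnatr_eq0 -lt0n.
  have csE (B : {set 'I_n}) : (charsum m B)%:~R =
      (e B + (B == set0)%:R) * (2 ^+ n / m%:R) :> R.
    by rewrite /e subrK; field; rewrite mR gt_eqF.
  rewrite corr csE A0 addr0; under eq_bigr do rewrite csE mulrA.
  rewrite -mulr_suml -mulrDl; apply/eqP; rewrite mulf_eq0; apply/orP; left; apply/eqP.
  under eq_bigr do rewrite mulrDr symdiff_eq0.
  have -> : \sum_B (c B * e (symdiff A B) + c B * (A == B)%:R) =
      c A + \sum_B E A B * c B.
    rewrite big_split /= addrC; congr (_ + _).
      rewrite (bigD1 A) //= eqxx mulr1 big1 ?addr0 // => B.
      by rewrite eq_sym => /negPf->; rewrite mulr0.
    apply: eq_bigr => B _; rewrite /E AL /= mulrC.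
    by case: ifP => // /negbT/c0->; rewrite !mulr0.
  by rewrite hc /e' AL subrr.
exists n, (fun x => g x / Z); split=> //.
- by move=> x; rewrite divr_ge0 // ltW.
- by rewrite -mulr_suml divff // gt_eqF.
split=> [x|A hA].
  by rewrite /g; case: ifP => //; rewrite mul0r eqxx.
under eq_bigr do rewrite mulrAC.
by rewrite -mulr_suml corr0 ?mul0r // inE.
Qed.

(** * Sign products over independent blocks *)

(** Expanding the product over [i] gives one term for each set [K] of indices.
    Its expectation factors over the blocks; if [K] is not empty, then one
    block contains between [1] and [k] of the positions of [K], and its factor
    vanishes. *)
Lemma independent_blocks_expectation (R : comPzRingType) (n J k : nat)
    (mu : {set 'I_n} -> R) (I : finType) (blk : I -> 'I_J) (off : I -> 'I_n)
    (al be : I -> R) :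
  \sum_x mu x = 1 ->
  (forall A : {set 'I_n}, (0 < #|A| <= k)%N ->
     \sum_x mu x * (-1) ^+ #|A :&: x| = 0) ->
  injective (fun i => (blk i, off i)) -> (#|I| <= k)%N ->
  \sum_(w : {ffun 'I_J -> {set 'I_n}}) (\prod_j mu (w j)) *
     (\prod_i (be i * (-1) ^+ (off i \in w (blk i)) + al i)) = \prod_i al i.
Proof.
move=> mu1 muA inj Ik.
pose trace (K : {set I}) j := off @: [set i in K | blk i == j].
have signs (K : {set I}) (w : {ffun 'I_J -> {set 'I_n}}) :
    \prod_(i in K) (-1) ^+ (off i \in w (blk i)) =
    \prod_j (-1) ^+ #|trace K j :&: w j| :> R.
  rewrite (partition_big blk predT) //=; apply: eq_bigr => j _.
  rewrite prodrXr; congr (_ ^+ _).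
  transitivity (\sum_(a in trace K j) (a \in w j : nat))%N.
    rewrite big_imset /=; last first.
      move=> i i'; rewrite !inE => /andP[_ /eqP bi] /andP[_ /eqP bi'] oi.
      by apply: inj; rewrite /= bi bi' oi.
    under [RHS]eq_bigl do rewrite inE.
    by apply: eq_bigr => i /andP[_ /eqP->].
  rewrite -sum1_card big_mkcond [RHS]big_mkcond; apply: eq_bigr => a _.
  by rewrite inE; do 2!case: (_ \in _).
pose coef (K : {set I}) := (\prod_(i in K) be i) * (\prod_(i in ~: K) al i).
have expand (w : {ffun 'I_J -> {set 'I_n}}) :
    \prod_i (be i * (-1) ^+ (off i \in w (blk i)) + al i) =
    \sum_(K : {set I}) coef K * \prod_j (-1) ^+ #|trace K j :&: w j|.
  rewrite bigA_distr; apply: eq_bigr => K _.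
  rewrite -signs /coef mulrAC -big_split /= [X in X * _]big_mkcond /=.
  rewrite [X in _ * X]big_mkcond -big_split; apply: eq_bigr => i _.
  by rewrite inE; case: (i \in K); rewrite /= ?mulr1 ?mul1r.
under [LHS]eq_bigr do rewrite expand mulr_sumr.
rewrite exchange_big /= (bigD1 set0) //= [X in _ + X]big1 ?addr0; last first.
  move=> K /set0Pn[i0 i0K].
  under eq_bigr do rewrite mulrCA -big_split.
  rewrite -mulr_sumr -(bigA_distr_bigA (fun j x => mu x * (-1) ^+ #|trace K j :&: x|)) /=.
  rewrite (bigD1 (blk i0)) //= muA ?mul0r ?mulr0 //; apply/andP; split.
    by apply/card_gt0P; exists (off i0); apply: imset_f; rewrite inE i0K /=.
  by apply: leq_trans Ik; apply: leq_trans (leq_imset_card _ _) (max_card _).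
have mass1 : \sum_(w : {ffun 'I_J -> {set 'I_n}}) \prod_j mu (w j) = 1.
  by rewrite -(bigA_distr_bigA (fun j x => mu x)) big1 // => j _; exact: mu1.
rewrite -[RHS]mul1r -[X in _ = X * _]mass1 mulr_suml; apply: eq_bigr => w _.
rewrite /coef big_set0 mul1r; congr (_ * _).
rewrite [X in _ * X]big1 ?mulr1; last first.
  move=> j _; rewrite (_ : trace _ _ = set0) ?set0I ?cards0 //.
  by apply/setP => a; rewrite inE; apply/imsetP => -[i]; rewrite !inE.
by apply: eq_bigl => i; rewrite !inE.
Qed.

Lemma sum_divn_modn (V : nmodType) (n J : nat) (F : nat -> nat -> V) : (0 < n)%N ->
  \sum_(i < n * J) F (i %/ n)%N (i %% n)%N = \sum_(b < J) \sum_(r < n) F b r.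
Proof.
move=> n0; elim: J => [|J IH]; first by rewrite muln0 !big_ord0.
rewrite big_ord_recr /= -IH.
rewrite -!(big_mkord xpredT (fun i => F (i %/ n)%N (i %% n)%N)) mulnS addnC.
rewrite (big_cat_nat (n := (n * J)%N)) ?leq_addr //=; congr (_ + _).
rewrite -{1}[(n * J)%N]add0n big_addn addKn big_mkord; apply: eq_bigr => r _.
by rewrite addnC mulnC divnMDl // modnMDl divn_small // addn0 modn_small.
Qed.

Lemma sum_signs (R : pzRingType) (n : nat) (x : {set 'I_n}) :
  \sum_(r < n) (-1) ^+ (r \in x) = n%:R - (#|x| * 2)%:R :> R.
Proof.
rewrite (eq_bigr (fun r => 1 - (if r \in x then 2 else 0))); last first.
  move=> r _; case: (r \in x); rewrite ?subr0 //.
  by rewrite expr1 opprD addNKr.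
rewrite sumrB sumr_const card_ord; congr (_ - _).
by rewrite -big_mkcond sumr_const natrM mulr_natl.
Qed.

(** * Independent sequences with a given finite law *)

Import all_classical all_reals all_analysis.
Import Order.TTheory GRing.Theory Num.Theory.
Import numFieldNormedType.Exports.

Local Open Scope classical_set_scope.
Local Open Scope ring_scope.

Section Digits.
Variables (R : realType) (A : finType) (mu : A -> R).
Hypothesis mu_ge0 : forall a, 0 <= mu a.
Hypothesis mu_sum1 : \sum_a mu a = 1.

(** The unit interval is cut into consecutive slots of length [mu a], ordered
    by the enumeration of the alphabet: the letter [a]
    owns the points [u] with [slot a <= u < slot a + mu a]. *)
Definition mass_below (j : nat) : R := \sum_(b : A | (enum_rank b < j)%N) mu b.
Definition slot (a : A) : R := mass_below (enum_rank a).

Lemma mass_belowS (a : A) : mass_below (enum_rank a).+1 = slot a + mu a.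
Proof.
rewrite /slot /mass_below (bigD1 a) ?ltnSn //= addrC; congr (_ + _).
apply: eq_bigl => b; rewrite ltnS ltn_neqAle andbC; congr (_ && _).
by rewrite (inj_eq val_inj) (inj_eq enum_rank_inj).
Qed.

Lemma mass_below_le i j : (i <= j)%N -> mass_below i <= mass_below j.
Proof.
move=> ij; rewrite /mass_below [leLHS]big_mkcond [leRHS]big_mkcond.
apply: ler_sum => b _; case: ifP => bi; last by case: ifP.
by rewrite (leq_trans bi ij).
Qed.

Lemma mass_below0 : mass_below 0 = 0.
Proof. by rewrite /mass_below big_pred0. Qed.

Lemma mass_below_card : mass_below #|A| = 1.
Proof. by rewrite -mu_sum1; apply: eq_bigl => b; rewrite ltn_ord. Qed.

Lemma slot_ge0 a : 0 <= slot a.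
Proof. by rewrite -mass_below0 mass_below_le. Qed.

Lemma slot_le1 a : slot a + mu a <= 1.
Proof. by rewrite -mass_belowS -mass_below_card mass_below_le // ltn_ord. Qed.

Lemma slot_inj (u : R) a b : slot a <= u < slot a + mu a ->
  slot b <= u < slot b + mu b -> a = b.
Proof.
rewrite -!mass_belowS => /andP[au ua] /andP[bu ub].
apply: enum_rank_inj; apply: val_inj.
case: (ltngtP (enum_rank a) (enum_rank b)) => // h.
  by have := lt_le_trans ua (le_trans (mass_below_le h) bu); rewrite ltxx.
by have := lt_le_trans ub (le_trans (mass_below_le h) au); rewrite ltxx.
Qed.

Lemma slot_exists (u : R) : 0 <= u < 1 -> exists a, slot a <= u < slot a + mu a.
Proof.
move=> /andP[u0 u1].
have ex : exists j, u < mass_below j by exists #|A|; rewrite mass_below_card.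
case: (ex_minnP ex) => -[|j] uj jmin; first by move: uj; rewrite mass_below0 ltNge u0.
have jA : (j < #|A|)%N by apply: jmin; rewrite mass_below_card.
exists (enum_val (Ordinal jA)); rewrite -mass_belowS /slot enum_valK /= uj andbT.
by rewrite leNgt; apply/negP => /jmin; rewrite ltnn.
Qed.

Lemma card_gt0_of_law : (0 < #|A|)%N.
Proof.
rewrite lt0n; apply/eqP => A0; have := mu_sum1.
rewrite big_pred0 => [/eqP|a]; first by rewrite eq_sym oner_eq0.
by have /card0_eq/(_ a) := A0.
Qed.

Definition default_letter : A := enum_val (Ordinal card_gt0_of_law).

Definition digit (u : R) : A :=
  odflt default_letter [pick a | slot a <= u < slot a + mu a].

(** The position inside the slot of [u], rescaled to the unit interval.  A slot
    that contains [u] is not empty, so its length can be divided by. *)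
Definition shift (u : R) : R := (u - slot (digit u)) / mu (digit u).

Lemma digitP (u : R) a : 0 <= u < 1 -> (digit u == a) = (slot a <= u < slot a + mu a).
Proof.
move=> u01; rewrite /digit; case: pickP => [b hb|none] /=.
  by apply/eqP/idP => [<-//|ha]; exact: slot_inj hb ha.
by have [b] := slot_exists u01; rewrite none.
Qed.

Lemma shift01 (u : R) : 0 <= u < 1 -> 0 <= shift u < 1.
Proof.
move=> u01; have := digitP (digit u) u01; rewrite eqxx => /esym/andP[h1 h2].
have m0 : 0 < mu (digit u) by move: (le_lt_trans h1 h2); rewrite ltrDl.
by rewrite /shift divr_ge0 ?subr_ge0 //= ltr_pdivrMr // mul1r ltrBlDl.
Qed.

(** The points whose digits start with [w] form the interval of length
    [word_mass w] that starts here, as [digitsP] shows. *)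
Fixpoint word_start (w : seq A) : R :=
  if w is a :: w' then slot a + mu a * word_start w' else 0.

Definition word_mass (w : seq A) : R := \prod_(a <- w) mu a.

Definition digits (n : nat) (u : R) : seq A :=
  [seq digit (iter j shift u) | j <- iota 0 n].

Lemma digitsS n u : digits n.+1 u = digit u :: digits n (shift u).
Proof.
rewrite /digits /= (iotaDl 1 0) -map_comp; congr (_ :: _).
by apply: eq_map => j; rewrite /= -iterSr.
Qed.

Lemma word_mass_ge0 w : 0 <= word_mass w.
Proof. exact: prodr_ge0. Qed.

Lemma word_interval_sub01 w : 0 <= word_start w /\ word_start w + word_mass w <= 1.
Proof.
elim: w => [|a w [IH1 IH2]] /=; first by rewrite /word_mass big_nil add0r.
split; first by rewrite addr_ge0 ?slot_ge0 ?mulr_ge0.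
rewrite /word_mass big_cons -addrA -mulrDr; apply: le_trans (slot_le1 a).
by rewrite lerD2l ler_piMr.
Qed.

(** The cylinders of the digit process are intervals, so that their Lebesgue
    measure is known. *)
Lemma digitsP (w : seq A) u : 0 <= u < 1 ->
  (digits (size w) u == w) = (word_start w <= u < word_start w + word_mass w).
Proof.
elim: w u => [|a w IH] u u01; first by rewrite /word_mass big_nil add0r u01.
rewrite [size _]/= digitsS eqseq_cons (IH _ (shift01 u01)) (digitP _ u01).
have [s0 s1] := word_interval_sub01 w.
rewrite /= /word_mass big_cons -/(word_mass w) -addrA -mulrDr.
case: (boolP (slot a <= u < slot a + mu a)) => /= [ha|/negP na].
  have /eqP da : digit u == a by rewrite digitP.
  have /andP[a1 a2] := ha.
  have m0 : 0 < mu a by move: (le_lt_trans a1 a2); rewrite ltrDl.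
  rewrite /shift da ler_pdivlMr // ltr_pdivrMr //.
  by rewrite lerBrDl ltrBlDl ![_ * mu a]mulrC.
apply/esym/negP => /andP[h1 h2]; apply: na; apply/andP; split.
  by apply: le_trans h1; rewrite lerDl mulr_ge0.
by apply: lt_le_trans h2 _; rewrite lerD2l ler_piMr.
Qed.

End Digits.

Lemma finite_valued_law d (T : measurableType d) (R : realType)
    (P : probability T R) (V : finType) (f : T -> V) (p : V -> R) :
  (forall v, measurable [set t | f t == v]) ->
  (forall v, P [set t | f t == v] = (p v)%:E) ->
  forall Q : pred V, measurable [set t | Q (f t)] /\
    P [set t | Q (f t)] = (\sum_(v | Q v) p v)%:E.
Proof.
move=> mf pf Q.
suff H (s : seq V) : uniq s -> measurable [set t | f t \in s] /\
    P [set t | f t \in s] = (\sum_(v <- s) p v)%:E.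
  have [mQ PQ] := H (enum Q) (enum_uniq Q).
  rewrite big_enum /= in PQ.
  by under eq_set do rewrite -[Q _]/(_ \in Q) -mem_enum.
elim: s => [|v s IH] /=.
  move=> _; rewrite big_nil; under eq_set do rewrite in_nil.
  rewrite (_ : [set _ | false] = set0); first by rewrite measure0.
  by apply/seteqP; split.
move=> /andP[vs /IH[ms Ps]].
have -> : [set t | f t \in v :: s] = [set t | f t == v] `|` [set t | f t \in s].
  by apply/seteqP; split=> t /=; rewrite inE => /orP.
split; first exact: measurableU.
rewrite big_cons measureU //.
  by rewrite EFinD; congr (_ + _)%E; [exact: pf | exact: Ps].
apply/seteqP; split=> t //= [/eqP ->].
by rewrite (negPf vs).
Qed.

Lemma uniform_prob_interval (R : realType) (x p : R) :
  0 <= x -> 0 <= p -> x + p <= 1 ->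
  uniform_prob (@ltr01 R) `[x, x + p[ = p%:E.
Proof.
move=> x0 p0 xp1; rewrite /uniform_prob (eq_integral (fun=> 1%E)); last first.
  move=> u; rewrite inE /= in_itv /= => /andP[xu ux].
  rewrite /uniform_pdf subr0 invr1 (le_trans x0 xu) /=.
  by rewrite (le_trans (ltW ux) xp1).
rewrite integral_cst //= mul1e lebesgue_measure_itv /= lte_fin.
case: ltrP => h; first by rewrite -EFinB addrAC subrr add0r.
by congr (_%:E); apply/le_anti; rewrite p0 -(lerD2l x) addr0 h.
Qed.

(** Digits of a uniform point.  The points outside the unit interval,
    which have probability zero, are first sent to [0]. *)
Lemma iid_sequence (R : realType) (A : finType) (mu : A -> R) :
  (forall a, 0 <= mu a) -> \sum_a mu a = 1 ->
  exists d (T : measurableType d) (P : probability T R) (Y : nat -> T -> A),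
    forall J (Q : pred {ffun 'I_J -> A}),
      measurable [set t | Q [ffun i : 'I_J => Y i t]] /\
      P [set t | Q [ffun i : 'I_J => Y i t]] =
        (\sum_(w | Q w) \prod_i mu (w i))%:E.
Proof.
move=> mu0 mu1.
pose clip (u : R) := if 0 <= u < 1 then u else 0.
pose Y (j : nat) (u : R) : A := digit mu1 (iter j (shift mu1) (clip u)).
exists _, (measurableTypeR R), (uniform_prob (@ltr01 R)), Y => J.
pose word (w : {ffun 'I_J -> A}) := [seq w i | i <- enum 'I_J].
have sz w : size (word w) = J by rewrite size_map size_enum_ord.
have evE w u : ([ffun i : 'I_J => Y i u] == w) =
    (digits mu1 (size (word w)) (clip u) == word w).
  rewrite sz /digits -val_enum_ord -map_comp; apply/eqP/eqP => [<-|h].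
    by apply/eq_map => i; rewrite /= ffunE.
  apply/ffunP => i; rewrite ffunE.
  have /eq_in_map/(_ i) := h; apply; exact: mem_enum.
have mI : measurable (`[0%R, 1%R[ : set R) by exact: measurable_itv.
have split_w w : [set u | [ffun i : 'I_J => Y i u] == w] =
    `[word_start mu (word w), word_start mu (word w) + word_mass mu (word w)[
    `|` (if digits mu1 (size (word w)) 0 == word w then ~` `[0, 1[ else set0).
  apply/seteqP; split=> u /=; rewrite evE.
    rewrite /clip; case: ifP => u01 h.
      by left; rewrite in_itv /= -(digitsP mu0 mu1).
    by right; rewrite h /= in_itv /= u01.
  have [s0 s1] := word_interval_sub01 mu0 mu1 (word w).
  case=> [|].
    rewrite in_itv /= => hu.
    have u01 : 0 <= u < 1.
      by case/andP: hu => h1 h2; rewrite (le_trans s0 h1) (lt_le_trans h2 s1).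
    by rewrite /clip u01 (digitsP mu0 mu1).
  by case: ifP => //= h; rewrite in_itv /= => /negP/negPf n01; rewrite /clip n01.
have mw w : measurable [set u | [ffun i : 'I_J => Y i u] == w].
  rewrite split_w; apply: measurableU; first exact: measurable_itv.
  by case: ifP => _; [exact: measurableC | exact: measurable0].
apply: finite_valued_law => // w.
have null : uniform_prob (@ltr01 R) (~` `[0, 1[) = 0%E.
  rewrite probability_setC // -[X in (_ - X)%E]/(uniform_prob _ _).
  rewrite -[X in `[_, X[%classic]add0r uniform_prob_interval ?add0r //.
  by rewrite subee.
have [s0 s1] := word_interval_sub01 mu0 mu1 (word w).
rewrite split_w measureU0 //.
- apply: etrans (uniform_prob_interval s0 (word_mass_ge0 mu0 (word w)) s1) _.
  by rewrite /word_mass big_map big_enum.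
- by case: ifP => _; [exact: measurableC | exact: measurable0].
- by case: ifP => _; [exact: null | exact: measure0].
Qed.

(** * The sequence of signs *)

Section Construction.
Variables (R : realType) (m k n : nat) (mu : {set 'I_n} -> R).
Hypotheses (n_gt0 : (0 < n)%N) (mu_sum1 : \sum_x mu x = 1).
Hypothesis mu_char0 : forall A : {set 'I_n}, (0 < #|A| <= k)%N ->
  \sum_x mu x * (-1) ^+ #|(A :&: x)%SET| = 0.
Variables (d : measure_display) (T : measurableType d) (P : probability T R).
Variable Y : nat -> T -> {set 'I_n}.
Hypothesis Y_iid : forall J (Q : pred {ffun 'I_J -> {set 'I_n}}),
  measurable [set t | Q [ffun i : 'I_J => Y i t]] /\
  P [set t | Q [ffun i : 'I_J => Y i t]] = (\sum_(w | Q w) \prod_i mu (w i))%:E.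

Definition offset (i : nat) : 'I_n := Ordinal (ltn_pmod i n_gt0).

Definition sign_at (i : nat) (t : T) : R := (-1) ^+ (offset i \in Y (i %/ n) t).

(** The probability of [B] under the uniform law on [{1, -1}]. *)
Definition fair_mass (B : set R) : R := ((1 \in B)%:R + (-1 \in B)%:R) / 2.

(** On a sign [s], the indicator of [B] is the affine function
    [be * s + al], where [al] is [fair_mass B]; for indices outside [J] the
    event is trivial, hence [al = 1] and [be = 0]. *)
Lemma sign_at_joint_law (I : finType) (f : I -> nat) (J : {set I}) (B : I -> set R) :
  injective f -> (#|I| <= k)%N ->
  measurable [set t | forall i, i \in J -> B i (sign_at (f i) t)] /\
  P [set t | forall i, i \in J -> B i (sign_at (f i) t)] =
    (\prod_(i in J) fair_mass (B i))%:E.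
Proof.
move=> f_inj Ik.
pose N := (\max_i f i).+1.
have blkN i : (f i %/ n < N)%N.
  by rewrite ltnS (leq_trans (leq_div _ _)) // leq_bigmax.
pose blk i : 'I_N := Ordinal (blkN i).
pose Q (w : {ffun 'I_N -> {set 'I_n}}) :=
  [forall (i | i \in J), ((-1) ^+ (offset (f i) \in w (blk i)) : R) \in B i].
have -> : [set t | forall i, i \in J -> B i (sign_at (f i) t)] =
          [set t | Q [ffun i : 'I_N => Y i t]].
  apply/seteqP; split=> t /=.
    by move=> h; apply/forall_inP => i iJ; rewrite ffunE inE; exact: h.
  by move=> /forall_inP h i /h; rewrite ffunE inE.
have [mQ PQ] := Y_iid Q; split=> //; rewrite PQ; congr (_%:E).
pose al i := if i \in J then fair_mass (B i) else 1.
pose be i : R := if i \in J then ((1 \in B i)%:R - (-1 \in B i)%:R) / 2 else 0.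
have := @independent_blocks_expectation R n N k mu I blk (offset \o f) al be mu_sum1 mu_char0.
rewrite -[\prod_i al i]big_mkcond /= => <- //; last first.
  move=> i i' [fb fo]; apply: f_inj.
  by rewrite (divn_eq (f i) n) fb fo -divn_eq.
rewrite big_mkcond; apply: eq_bigr => w _.
have E i : be i * (-1) ^+ (offset (f i) \in w (blk i)) + al i =
    ((i \in J) ==> (((-1) ^+ (offset (f i) \in w (blk i)) : R) \in B i))%:R.
  rewrite /be /al /fair_mass; case: (i \in J) => /=; last by rewrite mul0r add0r.
  by case: (_ \in w _); rewrite ?expr1 ?expr0; field.
under [X in _ = _ * X]eq_bigr do rewrite /= E.
case: ifP => [/forall_inP h|/negbT].
  rewrite [X in _ * X]big1 ?mulr1 // => i _.
  by case: (boolP (i \in J)) => //= /h ->.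
rewrite negb_forall => /existsP[i /negPf hi].
by rewrite [X in _ * X](bigD1 i) //= hi mul0r mulr0.
Qed.

Hypothesis k_gt0 : (0 < k)%N.

Lemma sign_at_law i (B : set R) :
  measurable (sign_at i @^-1` B) /\ P (sign_at i @^-1` B) = (fair_mass B)%:E.
Proof.
have [] := @sign_at_joint_law 'I_1 (fun=> i) [set: 'I_1]%SET (fun=> B).
- by move=> x y _; rewrite !ord1.
- by rewrite card_ord.
rewrite (eq_bigl xpredT) ?big_ord1 => [|j]; last by rewrite finset.in_setT.
have -> : [set t | forall j : 'I_1, j \in [set: 'I_1]%SET -> B (sign_at i t)] =
          sign_at i @^-1` B => [|//].
apply/seteqP; split=> t /= h; last by move=> _ _.
by apply: (h ord0); rewrite finset.in_setT.
Qed.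

Lemma measurable_sign_at i : measurable_fun setT (sign_at i).
Proof. by move=> _ B _; rewrite setTI; have [] := sign_at_law i B. Qed.

Definition sign_rv i : {RV P >-> R} := mfun_Sub (mem_set (measurable_sign_at i)).

Lemma sign_rv_fair i : fair_sign (sign_rv i).
Proof.
have neq : (1 == -1 :> R) = false.
  by apply/negbTE; rewrite -subr_eq0 opprK paddr_eq0 // oner_eq0.
split; apply: (etrans (proj2 (sign_at_law i _))); rewrite /fair_mass !in_set1.
  by rewrite eqxx eq_sym neq addr0 mul1r.
by rewrite eqxx neq add0r mul1r.
Qed.

Lemma sign_rv_kwise : kwise_independent k sign_rv.
Proof.
move=> f f_inj J B mB.
have [|_ PE] := sign_at_joint_law J B f_inj; first by rewrite card_ord.
rewrite (eq_bigr (fun i => (fair_mass (B i))%:E)); last first.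
  by move=> i _; have [_] := sign_at_law (f i) (B i).
by rewrite prodEFin -PE; congr (P _).
Qed.

Hypothesis n_dvd : (m %| n)%N.
Hypothesis mu_supp : forall x, mu x != 0 -> (m %| #|x|)%N.

(** An outcome of the first blocks for which the sum is not divisible gives
    some block a value of mass zero. *)
Lemma partial_sum_divisible j :
  P [set t | eq_mod m (partial_sum sign_rv (n * j.+1) t) 0] = 1%E.
Proof.
pose S (w : {ffun 'I_j.+1 -> {set 'I_n}}) : R :=
  \sum_(b < j.+1) (n%:R - (#|w b| * 2)%:R).
have SE t : partial_sum sign_rv (n * j.+1) t = S [ffun i : 'I_j.+1 => Y i t].
  rewrite /partial_sum /S /=.
  pose F b r : R := (-1) ^+ (offset r \in Y b t).
  transitivity (\sum_(i < n * j.+1) F (i %/ n)%N (i %% n)%N).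
    apply: eq_bigr => i _; rewrite /F /=.
    by rewrite (_ : offset (i %% n) = offset i) //; apply: val_inj; rewrite /= modn_mod.
  rewrite sum_divn_modn //; apply: eq_bigr => b _.
  rewrite ffunE -sum_signs; apply: eq_bigr => r _; rewrite /F.
  by rewrite (_ : offset r = r) //; apply: val_inj; rewrite /= modn_small.
have -> : [set t | eq_mod m (partial_sum sign_rv (n * j.+1) t) 0] =
    [set t | `[< eq_mod m (S [ffun i : 'I_j.+1 => Y i t]) 0 >]].
  by apply/seteqP; split=> t /=; rewrite SE => /asboolP.
have [_ ->] := Y_iid (fun w : {ffun 'I_j.+1 -> {set 'I_n}} => `[< eq_mod m (S w) 0 >]).
congr (_%:E).
have mass1 : \sum_(w : {ffun 'I_j.+1 -> {set 'I_n}}) \prod_i mu (w i) = 1.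
  by rewrite -(bigA_distr_bigA (fun i x => mu x)) big1 // => i _; exact: mu_sum1.
rewrite -[RHS]mass1 big_mkcond; apply: eq_bigr => w _.
case: asboolP => // nS; apply/esym/eqP; apply: contrapT => /negP.
move=> /prodf_neq0 w0; apply: nS.
rewrite /S /eq_mod subr0.
elim/big_ind: _ => [|x y [z1 ->] [z2 ->]|b _].
- by exists 0; rewrite mul0r.
- by exists (z1 + z2); rewrite intrD mulrDl.
have /dvdnP[q nq] := n_dvd; have /dvdnP[q' ->] := mu_supp (w0 b isT).
exists (q%:Z - (q' * 2)%:Z); rewrite intrB mulrBl -!pmulrn -!natrM -nq.
by rewrite mulnAC.
Qed.

End Construction.

Theorem theorem2 (R : realType) (m k : nat) (eps : R)
    (hm : (1 <= m)%N) (hk : (1 <= k)%N) (heps : 0 < eps) :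
  exists (d : measure_display) (T : measurableType d) (P : probability T R)
         (X : nat -> {RV P >-> R}) (I : nat -> nat),
    [/\ forall i, fair_sign (X i),
        kwise_independent k X,
        forall j, (0 < I j)%N,
        forall i j, (i < j)%N -> (I i < I j)%N &
        forall j, ((1 - eps)%:E <
          P [set w : T | eq_mod m (partial_sum X (I j) w) 0])%E].
Proof.
have [n [mu [n0 mn mu0 mu1 [mu_supp mu_char]]]] := block_law R k hm.
have [d [T [P [Y Y_iid]]]] := iid_sequence mu0 mu1.
exists d, T, P, (sign_rv n0 mu1 mu_char Y_iid hk), (fun j => n * j.+1)%N.
split.
- exact: sign_rv_fair.
- exact: sign_rv_kwise.
- by move=> j; rewrite muln_gt0 n0.
- by move=> i j ij; rewrite ltn_pmul2l.
- move=> j; rewrite partial_sum_divisible //.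
  by rewrite lte_fin ltrBlDr ltrDl.
Qed.
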